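(* If $T$ is a full binary tree of height $h$, then $\operatorname{th}_+(T)=h+1$.
   Context: All graphs are finite, simple and undirected. A full binary tree of height $h$ is a tree $T$ with a root vertex $r\in V(T)$ such that: (1) $\deg(r)=2$; (2) $\operatorname{dist}(v,r)\le h$ for all $v\in V(T)$; (3) for every $v\in V(T)$ with $v\ne r$, $\deg(v)=3$ if $\operatorname{dist}(v,r)<h$ and $\deg(v)=1$ if $\operatorname{dist}(v,r)=h$. (In particular $h\ge 1$.) Positive semidefinite (PSD) color change rule: each vertex of $G$ is blue or white; let $B$ be the current set of blue vertices and let $W_1,\dots,W_k$ be the vertex sets of the connected components of $G-B$. A white vertex $w\in W_i$ is colored blue (is forced by the blue vertex $v$) when $w$ is the only white neighbor of $v$ in the induced subgraph $G[W_i\cup B]$. Starting with exactly the vertices of $S\subseteq V(G)$ blue, at each time step all possible forces are performed simultaneously. $S$ is a PSD zero forcing set if eventually all vertices become blue; in that case $\operatorname{pt}_+(G;S)$ is the number of time steps needed to color all vertices blue (so it is $0$ if $S=V(G)$), and otherwise $\operatorname{pt}_+(G;S)=\infty$. Define $\operatorname{th}_+(G;S)=|S|+\operatorname{pt}_+(G;S)$, and the PSD throttling number $\operatorname{th}_+(G)=\min\{\operatorname{th}_+(G;S): S \text{ is a PSD zero forcing set of } G\}$. *)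

(* Defs.v *)
From mathcomp Require Import all_boot.

Set Implicit Arguments.
Unset Strict Implicit.
Unset Printing Implicit Defensive.

Record sgraph := SGraph {
  svertex :> finType;
  sedge : rel svertex;
  sedge_sym : symmetric sedge;
  sedge_irrefl : irreflexive sedge }.

Section Graphs.
Variable G : sgraph.
Implicit Types (x y v w r : G) (A B S W : {set G}).

Definition nbhd v : {set G} := [set w | sedge v w].
Definition deg v : nat := #|nbhd v|.

Definition has_walk x y (n : nat) : bool :=
  [exists p : n.-tuple G, path (@sedge G) x p && (last x p == y)].

(* Least length of a walk from x to y. A shortest walk has length < #|G|, so
   searching below #|G| is enough; the value is #|G| when y is not reachable. *)
Definition dist x y : nat := find (has_walk x y) (iota 0 #|G|).

(* Cycles of a simple graph have at least three vertices; ucycle also accepts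
   the degenerate sequences [::] and [:: x; y] with x adjacent to y. *)
Definition is_tree : Prop :=
  [/\ 0 < #|G|,
      forall x y, connect (@sedge G) x y
    & forall c : seq G, ucycle (@sedge G) c -> size c < 3].

(* The vertex sets of the connected components of G - B. *)
Definition del_edge B : rel G :=
  [rel x y | [&& x \notin B, y \notin B & sedge x y]].
Definition components_del B : {set {set G}} :=
  [set [set y | connect (del_edge B) x y] | x in ~: B].

Definition psd_force B W v w : bool :=
  [&& W \in components_del B, w \in W, v \in B
    & (nbhd v :&: (W :|: B)) :\: B == [set w]].

Definition psd_step B : {set G} :=
  B :|: [set w | [exists v, exists W, psd_force B W v w]].

Definition psd_blue S (t : nat) : {set G} := iter t psd_step S.

Definition psd_forcing S : Prop := exists t, psd_blue S t == [set: G].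

Lemma psd_step_sub B : B \subset psd_step B.
Proof. exact: subsetUl. Qed.

Lemma psd_blue_stable S : psd_step (psd_blue S #|G|) = psd_blue S #|G|.
Proof.
have H t : t <= #|psd_blue S t| \/ psd_step (psd_blue S t) = psd_blue S t.
  elim: t => [|t [IH|IH]]; first by left.
    have [eqB|neB] := eqVneq (psd_step (psd_blue S t)) (psd_blue S t).
      by right; rewrite /= !eqB.
    left; apply: leq_ltn_trans IH _; apply: proper_card.
    by rewrite properEneq eq_sym neB psd_step_sub.
  by right; rewrite /= !IH.
case: (H #|G|) => // le.
have -> : psd_blue S #|G| = setT.
  by apply/eqP; rewrite eqEcard subsetT cardsT.
by apply/eqP; rewrite eqEsubset subsetT psd_step_sub.
Qed.

Lemma psd_forcingP S :
  reflect (psd_forcing S) (psd_blue S #|G| == [set: G]).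
Proof.
apply: (iffP idP) => [H|[t /eqP Ht]]; first by exists #|G|.
have sub k n : psd_blue S n \subset psd_blue S (k + n).
  by elim: k => // k /subset_trans; apply; apply: psd_step_sub.
have stab k : psd_blue S (k + #|G|) = psd_blue S #|G|.
  by elim: k => // k IH; rewrite addSn /= -/(psd_blue S _) IH psd_blue_stable.
rewrite -subTset -(stab t) -Ht addnC; exact: sub.
Qed.

(* None stands for infinity. *)
Definition pt_plus S : option nat :=
  if psd_forcingP S is ReflectT forcing then Some (ex_minn forcing) else None.

Definition th_plus_of S : option nat := omap (addn #|S|) (pt_plus S).

Lemma th_plus_of_ex : exists k, [exists S, th_plus_of S == Some k].
Proof.
exists (#|[set: G]| + 0); apply/existsP; exists setT.
rewrite /th_plus_of /pt_plus; case: psd_forcingP => [forcing|[]]; last by exists 0.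
by case: ex_minnP => m _ /(_ 0 (eqxx _)); rewrite leqn0 => /eqP ->.
Qed.

Definition th_plus : nat := ex_minn th_plus_of_ex.

Definition full_binary_tree (h : nat) : Prop :=
  is_tree /\ exists r,
    [/\ deg r = 2,
        forall v, dist v r <= h
      & forall v, v != r -> (dist v r < h -> deg v = 3)
                            /\ (dist v r = h -> deg v = 1)].

End Graphs.

(* Main.v *)
Require Import Defs.
From mathcomp Require Import all_boot.

(** In any graph a forced vertex is adjacent to a vertex that is already blue,
    so blue spreads by at most one edge per step. A rooted tree is encoded by
    its parent map: every edge joins a vertex to its parent ([edge_parent]), so
    the only edge that leaves the subtree of descendants of [u] is the one
    between [u] and its parent ([edge_leaves_descendants]).

    Upper bound: start from the root [r] alone. When the blue vertices are those
    of depth at most [t], the subtrees hanging below them are pairwise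
    separated, so each vertex of depth [t] forces all its children at once.
    The tree is therefore blue after [h] steps, and the cost is [1 + h]
    ([psd_blue_root]).

    Lower bound: suppose that [S] colors everything in [p] steps. If [S] misses
    the subtree of [u], blue can enter it only through [u], and not before the
    first step, so after [p] steps it has not reached the vertices lying [p]
    levels below [u] ([blue_depth_lt]). Hence [S] meets the subtree of every
    vertex that has [p] levels below it. A vertex with [k] levels below it,
    where [p <= k], thus has at least [k - p + 1] elements of [S] in its
    subtree: this is the previous remark when [k = p], and otherwise two of
    its children contribute [k - p] each, with [2 (k - p) >= k - p + 1]
    ([card_blue_descendants]). At the root this reads [#|S| + p >= h + 1]. *)

Set Implicit Arguments.
Unset Strict Implicit.
Unset Printing Implicit Defensive.

(** * Throttling as an optimization over finite propagation times *)

Lemma th_plus_ofP (G : sgraph) (S : {set G}) k :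
  th_plus_of S = Some k -> exists2 p, k = #|S| + p & psd_blue S p = setT.
Proof.
rewrite /th_plus_of /pt_plus; case: psd_forcingP => // forcing.
by case: ex_minnP => p /eqP Sp _ [<-]; exists p.
Qed.

Lemma th_plus_of_le (G : sgraph) (S : {set G}) t :
  psd_blue S t = setT -> exists2 k, th_plus_of S = Some k & k <= #|S| + t.
Proof.
move=> St; rewrite /th_plus_of /pt_plus.
case: psd_forcingP => [forcing|[]]; last by exists t; rewrite St.
case: ex_minnP => p _ min_p; exists (#|S| + p) => //.
by rewrite leq_add2l min_p // St.
Qed.

Lemma psd_stepP (G : sgraph) (B : {set G}) w :
  w \in psd_step B -> w \in B \/ exists2 v, v \in B & sedge v w.
Proof.
rewrite inE => /orP[|]; first by left.
rewrite inE => /existsP[v /existsP[W /and4P[_ _ vB /eqP forced]]].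
right; exists v => //.
by have := set11 w; rewrite -forced !inE => /andP[_ /andP[]].
Qed.

(** * Distances *)

Lemma has_walkP (G : sgraph) (x y : G) n :
  reflect (exists p, [/\ size p = n, path (@sedge G) x p & last x p = y])
          (has_walk x y n).
Proof.
apply: (iffP existsP) => [[p /andP[xp /eqP py]]|[p [sp xp py]]].
  by exists p; rewrite size_tuple.
have sp' : size p == n by apply/eqP.
by exists (Tuple sp'); rewrite /= xp py eqxx.
Qed.

Lemma dist_le (G : sgraph) (x y : G) n : has_walk x y n -> dist x y <= n.
Proof.
move=> xyn; have [n_lt|n_ge] := ltnP n #|G|; last first.
  by apply: leq_trans n_ge; rewrite -[X in _ <= X](size_iota 0) find_size.
rewrite leqNgt; apply/negP => /(before_find 0).
by rewrite nth_iota // add0n xyn.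
Qed.

Lemma dist_walk (G : sgraph) (x y : G) :
  connect (@sedge G) x y -> has_walk x y (dist x y).
Proof.
case/connectP => p xp ->; case/shortenP: xp => q xq uq _.
have walk : has (has_walk x (last x q)) (iota 0 #|G|).
  apply/hasP; exists (size q); last by apply/has_walkP; exists q.
  by rewrite mem_iota /= add0n -[(size q).+1]/(size (x :: q)) -(card_uniqP uq) max_card.
have := nth_find 0 walk; rewrite nth_iota ?add0n //.
by rewrite -[X in _ < X](size_iota 0) -has_find.
Qed.

(** * Rooted trees *)

(** Two neighbors of [x] that are joined outside [x] close up to a cycle
    through [x]. *)
Lemma acyclic_separation (G : sgraph) (x a b : G) :
    (forall c : seq G, ucycle (@sedge G) c -> size c < 3) ->
    sedge x a -> sedge x b -> connect (del_edge [set x]) a b ->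
  a = b.
Proof.
move=> acyclic xa xb /connectP[p ap bE]; move: xb; rewrite {b}bE.
case/shortenP: ap => q aq uq _ xb.
have edge_path (z : G) s : path (del_edge [set x]) z s ->
    path (@sedge G) z s /\ x \notin s.
  elim: s z => //= y s IHs z /andP[/and3P[_ yx zy] /IHs[-> xs]].
  by rewrite zy inE negb_or xs eq_sym -in_set1 yx.
have [aq' xq] := edge_path _ _ aq. move: uq => /= uq.
have := acyclic (x :: a :: q).
rewrite /ucycle /= rcons_path xa aq' /= sedge_sym xb inE negb_or xq uq andbT.
rewrite andbT; have -> : x != a by apply: contraTneq xa => ->; rewrite sedge_irrefl.
by move=> /(_ isT); case: (q).
Qed.

(** The root is its own parent, so that the map is total and its orbits run
    from a vertex up to the root. *)
Definition parent (G : sgraph) (r x : G) : G :=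
  odflt x [pick y | sedge x y && (dist x r == (dist y r).+1)].

Definition descendants (G : sgraph) (r u : G) : {set G} :=
  [set x | fconnect (parent r) x u].

Definition children (G : sgraph) (r u : G) : {set G} :=
  [set x in nbhd u | dist x r == (dist u r).+1].

Section RootedTree.
Variables (G : sgraph) (r : G).
Hypothesis treeG : is_tree G.
Implicit Types (x y u v w : G) (S : {set G}).
Notation depth x := (dist x r).
Notation f := (parent r).

Lemma edge_neq x y : sedge x y -> x != y.
Proof. by apply: contraTneq => ->; rewrite sedge_irrefl. Qed.

Lemma walk_root x : has_walk x r (depth x).
Proof. by case: treeG => _ conn _; apply: dist_walk. Qed.

Lemma depth_root : depth r = 0.
Proof.
by apply/eqP; rewrite -leqn0; apply: dist_le; apply/has_walkP; exists [::].
Qed.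

Lemma depth_eq0 x : depth x = 0 -> x = r.
Proof.
by move=> x0; have := walk_root x; rewrite x0 => /has_walkP[[|? ?] []].
Qed.

Lemma depth_edge x y : sedge x y -> depth x <= (depth y).+1.
Proof.
move=> xy; have /has_walkP[p [sp yp pr]] := walk_root y.
by apply: dist_le; apply/has_walkP; exists (y :: p); rewrite /= sp xy yp.
Qed.

Lemma parentP x : x != r -> sedge x (f x) /\ depth x = (depth (f x)).+1.
Proof.
move=> xr; rewrite /parent; case: pickP => [y /andP[xy /eqP] //|none].
have /has_walkP[[|y p] [sp]] := walk_root x.
  by move=> _ /= xE; rewrite xE eqxx in xr.
move=> /= /andP[xy yp] pr.
have := none y; rewrite xy /= eqn_leq depth_edge //= -sp ltnS.
by rewrite dist_le //; apply/has_walkP; exists p.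
Qed.

Lemma parent_root : f r = r.
Proof. by rewrite /parent; case: pickP => // y; rewrite depth_root andbF. Qed.

Lemma depth_parent x : depth (f x) = (depth x).-1.
Proof.
have [->|/parentP[_ ->] //] := eqVneq x r.
by rewrite parent_root depth_root.
Qed.

Lemma depth_iter n x : depth (iter n f x) = depth x - n.
Proof. by elim: n => [|n IH]; rewrite ?subn0 //= depth_parent IH subnS. Qed.

(** The ancestors of [y] have smaller depth, so climbing from [y] to the root
    never meets a vertex [x] at least as deep as [y]. *)
Lemma connect_root_avoiding x y :
  x != y -> depth y <= depth x -> connect (del_edge [set x]) y r.
Proof.
elim: {y}(depth y) {-2}y (erefl (depth y)) => [|n IHn] y yn xy yx.
  by rewrite (depth_eq0 yn).
have yr : y != r by apply/eqP => yE; rewrite yE depth_root in yn.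
have [yfy dy] := parentP yr; have fn : depth (f y) = n by rewrite depth_parent yn.
have xf : x != f y.
  by apply: contraTneq yx => ->; rewrite fn yn ltnn.
have fyx : depth (f y) <= depth x by rewrite fn ltnW // -yn.
apply: connect_trans (connect1 _) (IHn _ fn xf fyx).
by rewrite /del_edge /= !inE yfy !(eq_sym _ x) xy xf.
Qed.

(** If [y] were a neighbor of [x] no deeper than [x] and other than its
    parent, the two ascents to the root would close a cycle through [x]. *)
Lemma edge_parent x y : sedge x y -> y = f x \/ x = f y.
Proof.
wlog yx : x y / depth y <= depth x => [H xy|xy].
  have [/H|/H] := orP (leq_total (depth y) (depth x)); first exact.
  by rewrite sedge_sym => /(_ xy)/or_comm.
have xr : x != r.
  apply: contraTneq xy => xE; rewrite xE depth_root leqn0 in yx.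
  by rewrite xE (depth_eq0 (eqP yx)) sedge_irrefl.
have [xfx dx] := parentP xr; left.
have [_ _ acyclic] := treeG; apply: (acyclic_separation acyclic xy xfx).
have del_sym : connect_sym (del_edge [set x]).
  by apply: sym_connect_sym => u v; rewrite /del_edge /= sedge_sym andbCA.
apply: connect_trans (connect_root_avoiding (edge_neq xy) yx) _.
by rewrite del_sym connect_root_avoiding ?edge_neq // dx.
Qed.

Lemma childrenP u c : reflect (f c = u /\ c != r) (c \in children r u).
Proof.
rewrite !inE; apply: (iffP andP) => [[uc /eqP dc]|[<- /parentP[cf ->]]]; last first.
  by rewrite sedge_sym.
have cr : c != r by apply: contra_eq_neq dc => ->; rewrite depth_root.
split=> //; case: (edge_parent uc) => [cE|<- //].
by move: dc; rewrite cE depth_parent => /eqP; rewrite eqn_leq ltnNge leq_pred andbF.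
Qed.

Lemma depth_child u c : c \in children r u -> depth c = (depth u).+1.
Proof. by case/childrenP => <- /parentP[]. Qed.

(** Only the parent of [u] can be a neighbor that is not a child. *)
Lemma card_children u : (deg u).-1 <= #|children r u|.
Proof.
have sub : nbhd u \subset f u |: children r u.
  apply/subsetP => y; rewrite inE in_setU1 => uy.
  case: (edge_parent uy) => [->|uE]; first by rewrite eqxx.
  have [yr|yr] := eqVneq y r; first by rewrite uE yr !parent_root eqxx.
  by apply/orP; right; apply/childrenP.
have := subset_leq_card sub; rewrite cardsU1 -/(deg u).
by case: (_ \notin _) (deg u) => [] [|n] //= /ltnW.
Qed.

Lemma card_children_root : #|children r r| = deg r.
Proof.
apply: eq_card => y; rewrite !inE; case ry: (sedge r y) => //=.
have yr : y != r by rewrite eq_sym edge_neq.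
rewrite depth_root eqn_leq -{1}depth_root depth_edge 1?sedge_sym //=.
by rewrite lt0n; apply: contra yr => /eqP/depth_eq0->.
Qed.

Lemma descendants_refl u : u \in descendants r u.
Proof. by rewrite inE connect0. Qed.

Lemma descendants_child u c :
  c \in children r u -> descendants r c \subset descendants r u.
Proof.
case/childrenP => <- _; apply/subsetP => x; rewrite !inE => xc.
exact: connect_trans xc (fconnect1 _ _).
Qed.

Lemma ancestor_same_depth u v : fconnect f u v -> depth u = depth v -> u = v.
Proof.
move=> uv; rewrite -(iter_findex uv); case: (findex _ _ _) => // n /eqP.
rewrite depth_iter eq_sym => /eqP uE.
have u0 : depth u = 0 by move: uE; case: (depth u) => // m; rewrite subSS => mE;
  have := leq_subr n m; rewrite mE ltnn.
by rewrite [RHS]depth_eq0 ?(depth_eq0 u0) // depth_iter depth_root.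
Qed.

(** The ancestors of a vertex form a chain, on which depth is injective. *)
Lemma descendants_disjoint u v :
  u != v -> depth u = depth v -> [disjoint descendants r u & descendants r v].
Proof.
move=> neq duv; apply/pred0P => x; apply: contraNF neq => /andP[].
rewrite !inE => /iter_findex uE /iter_findex vE; move: uE vE duv.
move: (findex _ _ _) (findex _ _ _) => n m.
wlog le_mn : m n u v / m <= n => [H|] uE vE duv.
  case/orP: (leq_total m n) => le; first exact: (H m n).
  by rewrite eq_sym (H n m).
apply/eqP/ancestor_same_depth => //.
by rewrite -vE -(subnK le_mn) iterD uE fconnect_iter.
Qed.

Lemma edge_leaves_descendants u x y :
    sedge x y -> x \in descendants r u -> y \notin descendants r u ->
  x = u /\ y = f u.
Proof.
rewrite !inE => xy xu yu; case: (edge_parent xy) => [yE|xE]; last first.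
  by case/negP: yu; apply: connect_trans _ xu; rewrite xE fconnect1.
suff xE : x = u by rewrite yE xE.
move: yu; rewrite yE -(iter_findex xu); case: (findex _ _ _) => // n.
by rewrite iterSr fconnect_iter.
Qed.

(** * Propagation in a rooted tree *)

(** Once the parent [v] of [w] is blue, the component of [w] stays below [w]:
    in particular it contains no other child of [v]. *)
Lemma component_child (B : {set G}) v w x :
    f w = v -> v \in B -> connect (del_edge B) w x -> x \in descendants r w.
Proof.
move=> fw vB /connectP[p wp ->{x}].
elim/last_ind: p wp => [|p x IHp]; first by rewrite descendants_refl.
rewrite rcons_path last_rcons => /andP[/IHp pw /and3P[_ xB px]].
apply: contraNT xB => xw.
by case: (edge_leaves_descendants px pw xw) => _ ->; rewrite fw.
Qed.

Lemma psd_blue_root t : psd_blue [set r] t = [set x | depth x <= t].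
Proof.
elim: t => [|t IHt].
  apply/setP => x; rewrite !inE leqn0.
  by apply/eqP/eqP => [->|/depth_eq0 //]; rewrite depth_root.
rewrite /psd_blue iterS -/(psd_blue _ _) IHt; apply/setP => w.
apply/idP/idP => [/psd_stepP[|[v]]|]; rewrite !inE.
- exact: leqW.
- by move=> vt; rewrite sedge_sym => /depth_edge/leq_trans; apply.
rewrite leq_eqVlt ltnS => /orP[/eqP dw|->//]; apply/orP; right.
have wr : w != r by apply: contra_eq_neq dw => ->; rewrite depth_root.
have [wfw dfw] := parentP wr; have fwt : depth (f w) = t by rewrite depth_parent dw.
set B := [set x | _]; have fwB : f w \in B by rewrite inE fwt.
apply/existsP; exists (f w); apply/existsP.
exists [set y | connect (del_edge B) w y]; apply/and4P; split => //.
- by apply/imsetP; exists w; rewrite ?inE ?dw ?ltnn.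
- by rewrite inE.
apply/eqP/setP => x; rewrite !inE; apply/idP/eqP => [|->]; last first.
  by rewrite dw ltnn sedge_sym wfw connect0.
case/and3P=> xt fwx; rewrite (negPf xt) orbF => /(component_child erefl fwB).
rewrite inE => xw; apply: ancestor_same_depth xw _; apply/eqP.
rewrite dw eqn_leq ltnNge xt andbT -fwt.
by rewrite depth_edge // sedge_sym.
Qed.

(** Blue enters the descendants of [u] through [u] itself, at the first step
    at the earliest, and then goes down one level per step. *)
Lemma blue_depth_lt S u t x :
    [disjoint S & descendants r u] ->
    x \in psd_blue S t -> x \in descendants r u ->
  depth x < depth u + t.
Proof.
move=> Su; elim: t x => [|t IHt] x; first by move=> /(disjointFr Su)->.
rewrite addnS ltnS => /psd_stepP[xt xu|[v vt vx] xu]; first exact/ltnW/IHt.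
rewrite sedge_sym in vx; have [vu|vu] := boolP (v \in descendants r u).
  exact: leq_trans (depth_edge vx) (IHt v vt vu).
by have [-> _] := edge_leaves_descendants vx xu vu; rewrite leq_addr.
Qed.

End RootedTree.

(** * Full binary trees *)

Section FullBinaryTree.
Variables (G : sgraph) (r : G) (h : nat).
Hypothesis treeG : is_tree G.
Hypothesis branching : forall u, dist u r < h -> 1 < #|children r u|.

Lemma deep_descendant u p : dist u r + p <= h ->
  exists2 x, x \in descendants r u & dist x r = dist u r + p.
Proof.
elim: p u => [|p IHp] u; first by exists u; rewrite ?descendants_refl ?addn0.
move=> up; have /branching/ltnW/card_gt0P[c uc] : dist u r < h.
  by apply: leq_trans up; rewrite addnS ltnS leq_addr.
have dc := depth_child treeG uc.
have [|x xc xp] := IHp c; first by rewrite dc addSnnS.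
by exists x; rewrite ?xp ?dc ?addSnnS // (subsetP (descendants_child treeG uc)).
Qed.

Lemma blue_meets_descendants (S : {set G}) p u :
    psd_blue S p = setT -> dist u r + p <= h ->
  0 < #|S :&: descendants r u|.
Proof.
move=> Sp /deep_descendant[x xu xp]; rewrite card_gt0 setI_eq0.
apply/negP => Su; have xS : x \in psd_blue S p by rewrite Sp.
by have := blue_depth_lt treeG Su xS xu; rewrite xp ltnn.
Qed.

(** The subtrees of height [p] hanging [k - p] levels below [u] are disjoint and
    each meets [S], which would give [2 ^ (k - p)] elements; the linear bound
    goes through the same induction and is all that a sum [#|S| + p] needs. *)
Lemma card_blue_descendants (S : {set G}) p k u :
    psd_blue S p = setT -> dist u r + k = h -> p <= k ->
  k - p < #|S :&: descendants r u|.
Proof.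
move=> Sp; elim: k u => [|k IHk] u uk pk.
  by rewrite (blue_meets_descendants Sp) // -uk leq_add2l.
have [pE|kp] := eqVneq p k.+1.
  by rewrite pE subnn (blue_meets_descendants Sp) // pE uk.
have {kp}pk : p <= k by rewrite -ltnS ltn_neqAle kp.
have /branching/card_gt1P[c [d [uc ud cd]]] : dist u r < h.
  by rewrite -uk addnS ltnS leq_addr.
have [dc dd] := (depth_child treeG uc, depth_child treeG ud).
have Sc := IHk c _ pk; have Sd := IHk d _ pk.
rewrite dc dd addSnnS in Sc Sd.
apply: (@leq_trans #|S :&: (descendants r c :|: descendants r d)|).
  have cd0 : (S :&: descendants r c) :&: (S :&: descendants r d) = set0.
    by rewrite setIACA (disjoint_setI0 (descendants_disjoint treeG cd _)) ?dc ?dd ?setI0.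
  rewrite setIUr cardsU cd0 cards0 subn0.
  apply: leq_trans (leq_add (Sc uk) (Sd uk)).
  by rewrite subSn // addSn ltnS addnS ltnS leq_addr.
apply/subset_leq_card/setIS.
by rewrite subUset !(descendants_child treeG).
Qed.

End FullBinaryTree.

Theorem proposition4p6 (T : sgraph) (h : nat) (hT : full_binary_tree T h) :
  th_plus T = h + 1.
Proof.
case: hT => treeT [r [deg_r depth_le deg_v]].
have branching u : dist u r < h -> 1 < #|children r u|.
  move=> uh; have [->|ur] := eqVneq u r; first by rewrite card_children_root ?deg_r.
  have [/(_ uh) deg_u _] := deg_v u ur.
  by have := card_children r treeT u; rewrite deg_u.
rewrite /th_plus; case: ex_minnP => k /existsP[S /eqP Sk] min_k.
apply/eqP; rewrite eqn_leq; apply/andP; split.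
  have blue_h : psd_blue [set r] h = setT.
    by rewrite (psd_blue_root r treeT); apply/setP => x; rewrite !inE depth_le.
  have [m rm m_le] := th_plus_of_le blue_h.
  rewrite cards1 addnC in m_le; apply: leq_trans m_le; apply: min_k.
  by apply/existsP; exists [set r]; rewrite rm.
have [p -> Sp] := th_plus_ofP Sk.
have [ph|hp] := leqP p h; last by rewrite addn1 (leq_trans hp) ?leq_addl.
have r0 : dist r r + h = h by rewrite depth_root.
have := card_blue_descendants treeT branching Sp r0 ph.
move=> /leq_trans/(_ (subset_leq_card (subsetIl _ _))) S_large.
by rewrite addn1 -{1}(subnK ph) -addSn leq_add2r.
Qed.
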